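(* Let $\mathcal X,\mathcal Y$ be sets, let $T:\mathcal X\to\mathcal Y$, $g:\mathcal X\to\mathbb R^d$ and $h:\mathcal Y\to\mathbb R^d$ be maps, and let $\epsilon_1,\epsilon_2\ge 0$ and $C>0$ be constants. Let $S$ be a measurable space (of latent semantic values). For each $x\in\mathcal X$ let $p(\cdot\mid x)$ be a probability measure on $S$, and for each $y\in\mathcal Y$ let $p(\cdot\mid y)$ be a probability measure on $S$. For each $x\in\mathcal X$ let $y^\star=y^\star(x)\in\mathcal Y$ be an ideal translation of $x$, i.e. $p(\cdot\mid y^\star)=p(\cdot\mid x)$. Assume: (1) (semantic anchoring) for all $x\in\mathcal X$, $\|g(x)-h(y^\star(x))\|_2\le\epsilon_1$; (2) (translation fidelity) for all $x\in\mathcal X$, $D_{\mathrm{KL}}\bigl(p(\cdot\mid x)\,\|\,p(\cdot\mid T(x))\bigr)\le\epsilon_2$; (3) (RKHS representation) $h(y)$ is the kernel mean embedding of $p(\cdot\mid y)$ for a positive-definite kernel $k$ on $S$, that is, $h(y)=\mathbb E_{s\sim p(\cdot\mid y)}[\varphi(s)]$ with $\varphi(s)=k(s,\cdot)$, and $0<k(s,s)\le C^2$ for all $s\in S$. For $x\in\mathcal X$ put $y=T(x)$, $\mathbf z=[\,g(x);\,h(y)\,]\in\mathbb R^{2d}$ and $\mathbf z^\star=[\,h(y^\star);\,h(y^\star)\,]\in\mathbb R^{2d}$. Then for every $x\in\mathcal X$, $$\|\mathbf z-\mathbf z^\star\|_2\;\le\;\epsilon_1+C\sqrt{2\,\ep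silon_2}.$$
   Context: $\mathcal X$ is the space of low-resource-language sentences, $\mathcal Y$ the space of English sentences, $T$ a translator, $g$ a multilingual encoder and $h$ an English encoder. $[a;b]\in\mathbb R^{2d}$ denotes the concatenation of $a,b\in\mathbb R^d$, and $\|\cdot\|_2$ is the Euclidean norm. $D_{\mathrm{KL}}$ is the Kullback–Leibler divergence with natural logarithm. The reproducing kernel Hilbert space $\mathcal H$ of $k$, in which the kernel mean embedding $h(y)$ takes values, is identified isometrically with (a subspace of) $\mathbb R^d$ with the Euclidean norm, so that $\|h(y)-h(y')\|_2=\|h(y)-h(y')\|_{\mathcal H}$ and $\langle\varphi(s),\varphi(s')\rangle=k(s,s')$; the map $\varphi$ is assumed measurable so that the expectations make sense. *)

(* Defs.v *)
From HB Require Import structures.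
From mathcomp Require Import all_boot all_order all_algebra.
From mathcomp Require Import all_classical all_reals all_analysis.

Set Implicit Arguments.
Unset Strict Implicit.
Unset Printing Implicit Defensive.

Import Order.TTheory GRing.Theory Num.Theory.
Import numFieldNormedType.Exports.

Local Open Scope classical_set_scope.
Local Open Scope charge_scope.
Local Open Scope ring_scope.

(* The library's own norm on ['rV[R]_n] is the sup norm, hence the explicit
   Euclidean structure. *)
Definition dot (R : realType) (n : nat) (u v : 'rV[R]_n) : R :=
  \sum_(i < n) u ord0 i * v ord0 i.

Definition norm2 (R : realType) (n : nat) (u : 'rV[R]_n) : R :=
  Num.sqrt (dot u u).

(* The Radon-Nikodym derivative is finite everywhere and positive [P]-almost
   everywhere when [P `<< Q], and the negative part of its logarithm is
   [P]-integrable, so the integral is meaningful in [\bar R], possibly [+oo]. *)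
Definition KL (disp : measure_display) (S : measurableType disp)
    (R : realType) (P Q : probability S R) : \bar R :=
  if `[< P `<< Q >] then
    (\int[P]_s (ln (fine ('d (charge_of_finite_measure P) '/d Q s)))%:E)%E
  else +oo%E.

(* Real kernels, with the usual convention that "positive definite" only asks
   the Gram matrices to be positive semidefinite. *)
Definition posdef_kernel (R : realType) (S : Type) (k : S -> S -> R) : Prop :=
  (forall s t, k s t = k t s) /\
  (forall (n : nat) (s : 'I_n -> S) (c : 'I_n -> R),
    0 <= \sum_(i < n) \sum_(j < n) c i * c j * k (s i) (s j)).

(* The inner product is a total function on [S -> R] but is only constrained
   on the carrier. Up to its values outside the carrier, a positive definite
   kernel has exactly one such space (Moore-Aronszajn). *)
Record rkhs (R : realType) (S : Type) (k : S -> S -> R) := Rkhs {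
  rkhs_carrier : set (S -> R);
  rkhs_inner : (S -> R) -> (S -> R) -> R;
  rkhs_zero : rkhs_carrier (fun=> 0);
  rkhs_linear : forall (a : R) (f g : S -> R),
    rkhs_carrier f -> rkhs_carrier g ->
    rkhs_carrier (fun s => a * f s + g s);
  rkhs_innerC : forall f g : S -> R,
    rkhs_carrier f -> rkhs_carrier g ->
    rkhs_inner f g = rkhs_inner g f;
  rkhs_inner_linear : forall (a : R) (f g e : S -> R),
    rkhs_carrier f -> rkhs_carrier g -> rkhs_carrier e ->
    rkhs_inner (fun s => a * f s + g s) e =
      a * rkhs_inner f e + rkhs_inner g e;
  rkhs_inner_gt0 : forall f : S -> R,
    rkhs_carrier f -> f <> (fun=> 0) -> 0 < rkhs_inner f f;
  rkhs_complete : forall u : nat -> S -> R,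
    (forall n, rkhs_carrier (u n)) ->
    (forall e : R, 0 < e -> exists N : nat, forall m n : nat,
       (N <= m)%N -> (N <= n)%N ->
       Num.sqrt (rkhs_inner (fun s => u m s - u n s)
                            (fun s => u m s - u n s)) < e) ->
    exists2 f : S -> R, rkhs_carrier f &
      (fun n : nat => Num.sqrt (rkhs_inner (fun s => u n s - f s)
                                           (fun s => u n s - f s)))
        @ \oo --> (0 : R);
  rkhs_kernel : forall s : S, rkhs_carrier (k s);
  rkhs_reproducing : forall (f : S -> R) (s : S),
    rkhs_carrier f -> rkhs_inner f (k s) = f s
}.

Definition rkhs_norm (R : realType) (S : Type) (k : S -> S -> R)
    (H : rkhs k) (f : S -> R) : R := Num.sqrt (rkhs_inner H f f).

(* [iota], restricted to the carrier of [H], is the isometric identification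
   of [H] with a linear subspace of R^d. *)
Definition isometric_embedding (R : realType) (S : Type) (k : S -> S -> R)
    (H : rkhs k) (d : nat) (iota : (S -> R) -> 'rV[R]_d) : Prop :=
  (forall (a : R) (f g : S -> R),
     rkhs_carrier H f -> rkhs_carrier H g ->
     iota (fun s => a * f s + g s) = a *: iota f + iota g) /\
  (forall f : S -> R, rkhs_carrier H f -> norm2 (iota f) = rkhs_norm H f).

(* s |-> k(s, .), seen in R^d. *)
Definition feature_map (R : realType) (S : Type) (k : S -> S -> R) (d : nat)
    (iota : (S -> R) -> 'rV[R]_d) (s : S) : 'rV[R]_d := iota (k s).

(* Borel measurability of an R^d-valued map, expressed on coordinates. *)
Definition measurable_vec (disp : measure_display) (S : measurableType disp)
    (R : realType) (d : nat) (phi : S -> 'rV[R]_d) : Prop :=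
  forall i : 'I_d, measurable_fun [set: S] (fun s => phi s ord0 i).

Definition expectation_vec (disp : measure_display) (S : measurableType disp)
    (R : realType) (d : nat) (P : probability S R) (phi : S -> 'rV[R]_d) :
    'rV[R]_d :=
  \row_(i < d) fine ('E_P[fun s => phi s ord0 i])%E.

(* Main.v *)
(* Put [P = pX x] and [Q = pY (T x)]. For [v = E_P phi - E_Q phi], the square
   of [norm2 v] is the difference under [P] and [Q] of the expectations of
   [dot v phi], which is bounded by [C * norm2 v]; so it suffices to know
   [|E_P f - E_Q f| <= M sqrt (2 KL(P, Q))] when [|f| <= M]. With [w = dP/dQ],
   this is Pinsker's inequality, obtained from the pointwise bound
   [3 (w - 1)^2 <= (2 w + 4) (w ln w - w + 1)]: AM-GM with a free parameter [a]
   replaces Cauchy-Schwarz and gives [E_Q |w - 1| <= a + KL / (2 a)], and then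
   [a] is optimised. *)
Require Import Defs.
From HB Require Import structures.
From mathcomp Require Import all_boot all_order all_algebra.
From mathcomp Require Import all_classical all_reals all_analysis.
From mathcomp Require Import measurable_realfun.
From mathcomp Require Import ring lra.

Set Implicit Arguments.
Unset Strict Implicit.
Unset Printing Implicit Defensive.

Import Order.TTheory GRing.Theory Num.Theory.
Import numFieldNormedType.Exports.

Local Open Scope classical_set_scope.
Local Open Scope ring_scope.
Local Open Scope charge_scope.

(** * Pointwise inequalities for the logarithm *)

(* The difference of the two sides has derivative
   [(w - 1)^3 / (w^2 (w + 2)^2)], so it is minimal at [w = 1], where it
   vanishes. *)
Lemma ln_rational_lower_bound (R : realType) (w : R) : 0 < w ->
  (w - 1) * (5 * w + 1) / (2 * w * (w + 2)) <= ln w.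
Proof.
move=> w0; rewrite -subr_ge0.
pose psi (x : R) : R := ln x - (x - 1) * (5 * x + 1) / (2 * x * (x + 2)).
pose dpsi (x : R) : R := (x - 1) ^+ 3 / (x ^+ 2 * (x + 2) ^+ 2).
have dv (x : R) : 0 < x -> is_derive x 1 psi (dpsi x).
  move=> x0.
  have D0 : 2 * x * (x + 2) != 0 by rewrite !mulf_neq0//; lra.
  have dL := is_derive1_ln x0.
  rewrite /psi.
  apply: is_derive_eq.
  rewrite /dpsi /GRing.scale/=.
  field.
  apply/andP; split; lra.
have psi1 : psi 1 = 0 by rewrite /psi ln1 subrr !mul0r subrr.
have cont (a b : R) : 0 < a -> {within `[a, b], continuous psi}.
  move=> a0; apply: derivable_within_continuous => x.
  rewrite in_itv/= => /andP[ax _].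
  by have [] := dv x (lt_le_trans a0 ax).
(* The mean value theorem writes [psi w] as [dpsi c * (w - 1)] with [c] between [w] and 1, so
   [w - 1] and [c - 1] have the same sign. *)
have sgn (c : R) : 0 < c -> 0 <= (c - 1) * dpsi c.
  move=> c0; rewrite /dpsi mulrA -exprS; apply: divr_ge0.
    exact: exprn_even_ge0.
  by rewrite mulr_ge0// sqr_ge0.
rewrite -/(psi w).
have [w1|w1|w1] := ltgtP w 1; last by rewrite w1 psi1.
- have [||c] := @MVT _ psi dpsi w 1 w1.
  + by move=> x; rewrite in_itv/= => /andP[wx _]; apply: dv; lra.
  + exact: cont.
  rewrite in_itv/= => /andP[wc c1].
  have c0 : 0 < c by lra.
  have := sgn _ c0; rewrite psi1; nra.
- have [||c] := @MVT _ psi dpsi 1 w w1.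
  + by move=> x; rewrite in_itv/= => /andP[wx _]; apply: dv; lra.
  + exact: cont.
  rewrite in_itv/= => /andP[wc c1].
  have c0 : 0 < c by lra.
  have := sgn _ c0; rewrite psi1; nra.
Qed.

(** Clearing denominators in the rational bound gives [(w - 1) * (5 * w + 1) <= (2 * w + 4) * w * ln
    w]; subtracting [(2 * w + 4) * (w - 1)] leaves exactly [3 * (w - 1) ^+ 2] on the left. At
    [w = 0] the claim reads 3 <= 4. *)
Lemma relative_entropy_quadratic_bound (R : realType) (w : R) : 0 <= w ->
  3 * (w - 1) ^+ 2 <= (2 * w + 4) * (w * ln w - w + 1).
Proof.
rewrite le_eqVlt => /predU1P[<-|w0]; first by lra.
have := ln_rational_lower_bound w0.
rewrite ler_pdivrMr; last by rewrite !mulr_gt0//; lra.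
nra.
Qed.

(** The right side is affine in [w] and [w * ln w], so it can be integrated term by term; the weight
    [2 * w + 4] has mean 6 when [w] is a probability density. *)
Lemma entropy_linearization (R : realType) (w a : R) : 0 <= w -> 0 < a ->
  `|w - 1| <= a * (2 * w + 4) / 6 + (w * ln w - w + 1) / (2 * a).
Proof.
move=> w0 a0; have Q := relative_entropy_quadratic_bound w0.
set E := w * ln w - w + 1 in Q *.
set b := 2 * w + 4 in Q *.
have b0 : 0 < b by rewrite /b; lra.
have E0 : 0 <= E.
  by rewrite -(pmulr_rge0 _ b0); apply: le_trans Q; rewrite mulr_ge0// sqr_ge0.
rewrite -ler_sqr ?nnegrE// ?addr_ge0 ?mulr_ge0 ?invr_ge0//; try lra.
rewrite real_normK ?num_real//.
(* This is (p + q)^2 = (p - q)^2 + 4pq, where 4pq does not depend on [a] and dominates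
   [(w - 1) ^+ 2] by [Q]. *)
have -> : (a * b / 6 + E / (2 * a)) ^+ 2 =
    (a * b / 6 - E / (2 * a)) ^+ 2 + b * E / 3.
  by field; lra.
have := sqr_ge0 (a * b / 6 - E / (2 * a)); lra.
Qed.

(** * Change of measure and integrability *)

(** Multiplying by a nonnegative density commutes with taking positive and negative parts.
    Integrability of [f] is not assumed, so [f] may be the logarithm of the density. *)
Lemma density_change_of_variables (disp : measure_display)
    (S : measurableType disp) (R : realType) (P Q : probability S R)
    (f : S -> \bar R) :
  P `<< Q -> measurable_fun [set: S] f ->
  (\int[Q]_s (f s * Radon_Nikodym_SigmaFinite.f P Q s) = \int[P]_s f s)%E.
Proof.
move=> PQ mf; set W := Radon_Nikodym_SigmaFinite.f P Q.
have W0 s : (0 <= W s)%E by exact: Radon_Nikodym_SigmaFinite.f_ge0.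
have Wfin s : W s \is a fin_num by exact: Radon_Nikodym_SigmaFinite.f_fin_num.
rewrite [LHS]integralE [RHS]integralE; congr (_ - _)%E.
- rewrite -(Radon_Nikodym_SigmaFinite.change_of_variables PQ)//; last first.
    exact: measurable_funepos.
  by apply: eq_integral => s _; rewrite !funeposE maxe_pMl// mul0e.
- rewrite -(Radon_Nikodym_SigmaFinite.change_of_variables PQ)//; last first.
    exact: measurable_funeneg.
  by apply: eq_integral => s _; rewrite !funenegE -mulNe maxe_pMl// mul0e.
Qed.

Lemma bounded_integrable (disp : measure_display) (S : measurableType disp)
    (R : realType) (P : {finite_measure set S -> \bar R}) (f : S -> R) (M : R) :
  measurable_fun [set: S] f -> (forall s, `|f s| <= M) ->
  P.-integrable [set: S] (EFin \o f).
Proof.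
move=> mf fM; apply: measurable_bounded_integrable => //.
- exact: fin_num_fun_lty.
- exists M; split => [|N MN s _]; first exact: num_real.
  exact: le_trans (fM s) (ltW MN).
Qed.

(** The lower bound makes the negative part integrable for a finite measure, and the bound on the
    signed integral then controls the positive part. This serves for [w * ln w], of which only an
    upper bound on the integral is given. *)
Lemma integrable_of_lower_bound (disp : measure_display)
    (S : measurableType disp) (R : realType)
    (Q : {finite_measure set S -> \bar R}) (u : S -> R) (c : R) :
  measurable_fun [set: S] u -> (forall s, - c <= u s) ->
  (\int[Q]_s (u s)%:E < +oo)%E -> Q.-integrable [set: S] (EFin \o u).
Proof.
move=> mu uc; rewrite integralE => uoo.
have mU : measurable_fun [set: S] (EFin \o u) by exact/measurable_EFinP.
have neg : (\int[Q]_s (EFin \o u)^\- s < +oo)%E.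
  apply: (@le_lt_trans _ _ (\int[Q]_s (`|c|)%:E)%E).
    apply: ge0_le_integral => //; first exact: measurable_funeneg.
    move=> s _; rewrite funenegE ge_max; apply/andP; split; rewrite lee_fin//.
    by rewrite lerNl (le_trans _ (uc s))// lerN2 ler_norm.
  rewrite integral_cst//= lte_mul_pinfty// ?lee_fin//; exact: fin_num_fun_lty.
have neg0 : (0 <= \int[Q]_s (EFin \o u)^\- s)%E by exact: integral_ge0.
have pos : (\int[Q]_s (EFin \o u)^\+ s < +oo)%E.
  move: uoo; rewrite lteBlDr ?ge0_fin_numE// => uoo.
  by rewrite (lt_le_trans uoo)// leey.
apply/integrableP; split => //.
rewrite -[X in (\int[_]_s X s)%E]/(abse \o (EFin \o u)) fune_abse.
rewrite ge0_integralD//; first exact: lte_add_pinfty.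
- exact: measurable_funepos.
- exact: measurable_funeneg.
Qed.

(** * Pinsker's inequality for bounded test functions *)

Lemma le_of_forall_scale (R : realType) (D M eps : R) : 0 <= M -> 0 <= eps ->
  (forall a, 0 < a -> D <= M * (a + eps / (2 * a))) ->
  D <= M * Num.sqrt (2 * eps).
Proof.
move=> M0; rewrite le_eqVlt => /predU1P[<- H|e0 H].
  rewrite mulr0 sqrtr0 mulr0 leNgt; apply/negP => D0.
  (* With [eps = 0] the infimum over [a] is not attained at a positive [a]; this one is small enough
     that [M * a < D]. *)
  have a0 : 0 < D / (2 * (M + 1)) by rewrite divr_gt0//; lra.
  have := H _ a0; rewrite mul0r addr0 mulrA ler_pdivlMr; last by lra.
  nra.
(* The minimiser of [a + eps / (2 * a)], where the two terms are equal. *)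
set r := Num.sqrt (eps / 2).
have r0 : 0 < r by rewrite sqrtr_gt0; lra.
have epsE : eps = 2 * r ^+ 2 by rewrite sqr_sqrtr; lra.
suff -> : Num.sqrt (2 * eps) = r + eps / (2 * r) by exact: H.
have -> : 2 * eps = (2 * r) ^+ 2 by rewrite exprMn epsE; ring.
rewrite sqrtr_sqr ger0_norm; last by lra.
by rewrite epsE; field; lra.
Qed.

(* The derivative in [KL] is only almost everywhere nonnegative; [w] is the
   library's everywhere finite and nonnegative version of it. *)
Lemma KL_density (disp : measure_display) (S : measurableType disp)
    (R : realType) (P Q : probability S R) (eps : R) :
  (KL P Q <= eps%:E)%E ->
  exists w : S -> R, [/\ measurable_fun [set: S] w, forall s, 0 <= w s,
    forall f : S -> R, measurable_fun [set: S] f ->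
      (\int[P]_s (f s)%:E = \int[Q]_s (f s * w s)%:E)%E &
    (\int[Q]_s (w s * ln (w s))%:E <= eps%:E)%E].
Proof.
rewrite /KL; case: asboolP => [PQ|_]; last by rewrite leye_eq.
pose W := Radon_Nikodym_SigmaFinite.f P Q.
have W0 s : (0 <= W s)%E by exact: Radon_Nikodym_SigmaFinite.f_ge0.
have Wfin s : W s \is a fin_num by exact: Radon_Nikodym_SigmaFinite.f_fin_num.
have mW : measurable_fun [set: S] W.
  exact: measurable_int (Radon_Nikodym_SigmaFinite.f_integrable PQ).
pose w s := fine (W s).
have mw : measurable_fun [set: S] w by exact: measurableT_comp.
have change f : measurable_fun [set: S] f ->
    (\int[P]_s (f s)%:E = \int[Q]_s (f s * w s)%:E)%E.
  move=> mf; rewrite -(density_change_of_variables PQ)//; last first.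
    exact/measurable_EFinP.
  by apply: eq_integral => s _; rewrite EFinM fineK.
move=> KLe; exists w; split => //; first by move=> s; exact: fine_ge0.
under eq_integral do rewrite mulrC.
rewrite -(change (fun s => ln (w s))); last exact: measurableT_comp.
rewrite (ae_eq_integral (fun s =>
  (ln (fine ('d (charge_of_finite_measure P) '/d Q s)))%:E))//.
- by apply/measurable_EFinP; do 2!apply: measurableT_comp => //.
- by apply/measurable_EFinP; do 2!apply: measurableT_comp => //.
(* The two versions of the derivative agree [Q]-almost everywhere, and absolute continuity transfers
   this to [P]. *)
- apply: (null_dominates_ae_eq _ PQ) => //.
  exact: ae_eq_comp (fun z => (ln (fine z))%:E) _ _
    (ae_eq_Radon_Nikodym_SigmaFinite PQ measurableT).
Qed.

Lemma pinsker (disp : measure_display) (S : measurableType disp) (R : realType)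
    (P Q : probability S R) (f : S -> R) (M eps : R) :
  measurable_fun [set: S] f -> (forall s, `|f s| <= M) -> 0 <= M -> 0 <= eps ->
  (KL P Q <= eps%:E)%E ->
  \int[P]_s f s - \int[Q]_s f s <= M * Num.sqrt (2 * eps).
Proof.
move=> mf fM M0 eps0 /KL_density[w [mw w0 change ule]].
apply: le_of_forall_scale => // a a0.
pose u s := w s * ln (w s).
have mu : measurable_fun [set: S] u.
  by apply: measurable_funM => //; exact: measurableT_comp.
have u_lower s : w s - 1 <= u s.
  have := relative_entropy_quadratic_bound (w0 s); rewrite -/(u s).
  have := w0 s; have := sqr_ge0 (w s - 1); nra.
have iu : Q.-integrable [set: S] (EFin \o u).
  apply: (@integrable_of_lower_bound _ _ _ _ _ 1) => //.
    by move=> s; have := u_lower s; have := w0 s; lra.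
  exact: le_lt_trans ule (ltry _).
have Iw : (\int[Q]_s (w s)%:E = 1)%E.
  transitivity (\int[P]_s (cst 1%:E s))%E.
    by rewrite (change (cst 1))//; apply: eq_integral => s _; rewrite mul1r.
  by rewrite integral_cst// mul1e; exact: probability_setT.
have iw : Q.-integrable [set: S] (EFin \o w).
  apply: (@integrable_of_lower_bound _ _ _ _ _ 0) => //.
    by move=> s; rewrite oppr0.
  by rewrite Iw ltry.
have i1 (c : R) : Q.-integrable [set: S] (EFin \o cst c).
  exact: finite_measure_integrable_cst.
have iF : Q.-integrable [set: S] (EFin \o f) by exact: bounded_integrable fM.
have iFw : Q.-integrable [set: S] (EFin \o (fun s => f s * w s)).
  apply: (@le_integrable _ _ _ _ _ _ _ (fun s => M%:E * (w s)%:E)%E) => //.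
  - by apply/measurable_EFinP; exact: measurable_funM.
  - move=> s _; rewrite -EFinM lee_fin !normrM ler_pM//.
    by rewrite (ger0_norm M0).
  - exact: integrableZl.
have Ru : \int[Q]_s u s <= eps.
  by rewrite -lee_fin fineK//; exact: integrable_fin_num.
have Rw : \int[Q]_s w s = 1 by rewrite /Rintegral Iw.
have R1 c : \int[Q]_s (cst c s) = c.
  by rewrite Rintegral_cst// [X in fine X](@probability_setT _ _ _ Q) mulr1.
have -> : \int[P]_s f s = \int[Q]_s (f s * w s).
  by rewrite /Rintegral change.
rewrite -RintegralB//.
(* Coefficients of [w], [u] and 1 in [M] times the bound of [entropy_linearization]; since [w] has
   mean 1, [al + ga = M * a] and [be * eps] add up to the target. *)
pose al := M * (a / 3 - 1 / (2 * a)).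
pose be := M / (2 * a).
pose ga := M * (2 * a / 3 + 1 / (2 * a)).
have ibu : Q.-integrable [set: S] (EFin \o (fun s => be * u s)).
  exact: (integrableZl measurableT be iu).
have iaw : Q.-integrable [set: S] (EFin \o (fun s => al * w s)).
  exact: (integrableZl measurableT al iw).
have iabw : Q.-integrable [set: S] (EFin \o (fun s => be * u s + al * w s)).
  exact: (integrableD measurableT ibu iaw).
apply: (@le_trans _ _ (\int[Q]_s ((be * u s + al * w s) + cst ga s))).
  apply: le_Rintegral => //.
  - exact: (integrableB measurableT iFw iF).
  - exact: (integrableD measurableT iabw (i1 ga)).
  - move=> s _; have -> : f s * w s - f s = f s * (w s - 1) by ring.
    apply: (le_trans (ler_norm _)); rewrite normrM.
    apply: (le_trans (ler_pM (normr_ge0 _) (normr_ge0 _) (fM s)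
      (entropy_linearization (w0 s) a0))).
    rewrite le_eqVlt; apply/orP; left; apply/eqP.
    rewrite /be /al /ga /cst -/(u s); field; lra.
rewrite RintegralD// RintegralD// RintegralZl// RintegralZl// R1 Rw.
apply: (@le_trans _ _ (be * eps + al * 1 + ga)).
  by rewrite !lerD2r ler_wpM2l// /be divr_ge0//; lra.
rewrite le_eqVlt; apply/orP; left; apply/eqP.
rewrite /be /al /ga; field; lra.
Qed.

(** * Euclidean norm and Cauchy-Schwarz *)

Section euclidean.
Context (R : realType) (n : nat).
Implicit Types u v : 'rV[R]_n.

Lemma dot_ge0 u : 0 <= dot u u.
Proof. by apply: sumr_ge0 => i _; rewrite -expr2 sqr_ge0. Qed.

Lemma norm2_ge0 u : 0 <= norm2 u.
Proof. exact: sqrtr_ge0. Qed.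

Lemma sqr_norm2 u : norm2 u ^+ 2 = dot u u.
Proof. exact/sqr_sqrtr/dot_ge0. Qed.

Lemma norm2N u : norm2 (- u) = norm2 u.
Proof.
by congr Num.sqrt; apply: eq_bigr => i _; rewrite mxE mulrNN.
Qed.

Lemma dotBr u v w : dot u (v - w) = dot u v - dot u w.
Proof.
by rewrite /dot -sumrB; apply: eq_bigr => i _; rewrite !mxE mulrBr.
Qed.

Lemma norm_coord_le_norm2 u i : `|u ord0 i| <= norm2 u.
Proof.
rewrite -sqrtr_sqr; apply: ler_wsqrtr.
rewrite /dot (bigD1 i)//= -expr2 lerDl.
by apply: sumr_ge0 => j _; rewrite -expr2 sqr_ge0.
Qed.

Lemma norm2_eq0 u : norm2 u = 0 -> u = 0.
Proof.
move=> u0; apply/rowP => i; rewrite mxE; apply/eqP.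
by rewrite -normr_le0 -u0 norm_coord_le_norm2.
Qed.

(** The square of [a *: u + b *: v] is nonnegative; take [a = norm2 v] and [b] equal to plus or
    minus [norm2 u], then divide by [norm2 u * norm2 v], which is why zero vectors are treated
    apart. *)
Lemma dot_le_norm2 u v : `|dot u v| <= norm2 u * norm2 v.
Proof.
have dot0 : (norm2 u = 0 \/ norm2 v = 0) -> dot u v = 0.
  case=> /norm2_eq0 ->; apply: big1 => i _; rewrite mxE; ring.
have expand (a b : R) : 0 <=
    a ^+ 2 * norm2 u ^+ 2 + 2 * a * b * dot u v + b ^+ 2 * norm2 v ^+ 2.
  rewrite !sqr_norm2; have := dot_ge0 (a *: u + b *: v).
  congr (_ <= _); rewrite /dot !mulr_sumr -!big_split/=.
  by apply: eq_bigr => i _; rewrite !mxE; ring.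
have [u0|/eqP u0] := eqVneq (norm2 u) 0.
  by rewrite dot0 ?normr0 ?mulr_ge0 ?norm2_ge0//; left.
have [v0|/eqP v0] := eqVneq (norm2 v) 0.
  by rewrite dot0 ?normr0 ?mulr_ge0 ?norm2_ge0//; right.
have up : 0 < norm2 u by rewrite lt_neqAle norm2_ge0 eq_sym andbT; exact/eqP.
have vp : 0 < norm2 v by rewrite lt_neqAle norm2_ge0 eq_sym andbT; exact/eqP.
have uv0 : 0 < norm2 u * norm2 v by rewrite mulr_gt0.
rewrite ler_norml; apply/andP; split; rewrite -(ler_pM2l uv0).
- by have := expand (norm2 v) (norm2 u); lra.
- by have := expand (norm2 v) (- norm2 u); lra.
Qed.

End euclidean.

Lemma norm2_row_mx_le (R : realType) (m n : nat) (u : 'rV[R]_m) (v : 'rV[R]_n) :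
  norm2 (row_mx u v) <= norm2 u + norm2 v.
Proof.
have E : norm2 (row_mx u v) ^+ 2 = norm2 u ^+ 2 + norm2 v ^+ 2.
  rewrite !sqr_norm2 /dot big_split_ord/=.
  by congr (_ + _); apply: eq_bigr => i _; rewrite ?row_mxEl ?row_mxEr.
rewrite -ler_sqr ?nnegrE ?addr_ge0 ?norm2_ge0// E.
have := mulr_ge0 (norm2_ge0 u) (norm2_ge0 v); lra.
Qed.

(** * Mean embeddings of two close distributions *)

Section mean_embedding.
Context (disp : measure_display) (S : measurableType disp) (R : realType).
Context (d : nat) (phi : S -> 'rV[R]_d) (C : R).
Hypothesis phi_measurable : measurable_vec phi.
Hypothesis phi_bounded : forall s, norm2 (phi s) <= C.

(** Each coordinate of [phi] is bounded by [C], hence integrable, so [fine] loses nothing and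
    linearity applies. *)
Lemma dot_expectation_vec (P : probability S R) (v : 'rV[R]_d) :
  dot v (expectation_vec P phi) = \int[P]_s dot v (phi s).
Proof.
have iphi i : P.-integrable [set: S] (EFin \o (fun s => phi s ord0 i)).
  apply: (@bounded_integrable _ _ _ _ _ C) => // s.
  exact: le_trans (norm_coord_le_norm2 _ _) (phi_bounded s).
apply: EFin_inj; rewrite /Rintegral /dot.
under eq_integral do rewrite -sumEFin.
rewrite integral_sum//=; last first.
  by move=> i; exact: (integrableZl measurableT (v ord0 i) (iphi i)).
rewrite [in RHS](eq_bigr (fun i =>
  (v ord0 i * expectation_vec P phi ord0 i)%:E)).
  by rewrite sumEFin.
move=> i _; rewrite mxE unlock EFinM fineK; last first.
  exact: (integrable_fin_num measurableT (iphi i)).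
by under eq_integral do rewrite EFinM; rewrite integralZl//; exact: (iphi i).
Qed.

Lemma norm2_expectation_vecB_le (P Q : probability S R) (eps : R) :
  0 <= C -> 0 <= eps -> (KL P Q <= eps%:E)%E ->
  norm2 (expectation_vec P phi - expectation_vec Q phi) <=
    C * Num.sqrt (2 * eps).
Proof.
move=> C0 eps0 KLe.
set v := expectation_vec P phi - expectation_vec Q phi.
have [v0|/eqP v0] := eqVneq (norm2 v) 0.
  by rewrite v0 mulr_ge0// sqrtr_ge0.
have vp : 0 < norm2 v by rewrite lt_neqAle norm2_ge0 eq_sym andbT; exact/eqP.
(* Only one factor of [dot v v] is unfolded; the other stays as the direction of the test function
   [dot v (phi s)]. *)
rewrite -(ler_pM2l vp) -expr2 sqr_norm2 {2}/v dotBr !dot_expectation_vec mulrA.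
apply: pinsker => //.
- apply: measurable_sum => i; exact: measurable_funM.
- move=> s; apply: (le_trans (dot_le_norm2 _ _)).
  by rewrite ler_wpM2l ?norm2_ge0.
- by rewrite mulr_ge0// norm2_ge0.
Qed.

End mean_embedding.

(** * Error of the concatenated representation *)

Theorem theorem1 (R : realType) (X Y : Type) (d : nat)
  (T : X -> Y) (g : X -> 'rV[R]_d) (h : Y -> 'rV[R]_d)
  (eps1 eps2 C : R)
  (eps1_ge0 : 0 <= eps1) (eps2_ge0 : 0 <= eps2) (C_gt0 : 0 < C)
  (disp : measure_display) (S : measurableType disp)
  (pX : X -> probability S R) (pY : Y -> probability S R)
  (ystar : X -> Y)
  (ideal_translation : forall (x : X) (A : set S),
     measurable A -> pY (ystar x) A = pX x A)
  (semantic_anchoring : forall x : X, norm2 (g x - h (ystar x)) <= eps1)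
  (translation_fidelity : forall x : X, (KL (pX x) (pY (T x)) <= eps2%:E)%E)
  (k : S -> S -> R) (k_posdef : posdef_kernel k)
  (H : rkhs k) (iota : (S -> R) -> 'rV[R]_d)
  (iota_isometric : isometric_embedding H iota)
  (phi_measurable : measurable_vec (feature_map k iota))
  (h_mean_embedding : forall y : Y,
     h y = expectation_vec (pY y) (feature_map k iota))
  (k_diag : forall s : S, 0 < k s s <= C ^+ 2) :
  forall x : X,
    let y := T x in
    let z : 'rV[R]_(d + d) := row_mx (g x) (h y) in
    let zstar : 'rV[R]_(d + d) := row_mx (h (ystar x)) (h (ystar x)) in
    norm2 (z - zstar) <= eps1 + C * Num.sqrt (2 * eps2).
Proof.
move=> x /=.
(* By the isometry and the reproducing property, the squared norm is [k s s]. *)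
have phiC s : norm2 (feature_map k iota s) <= C.
  have [_ isom] := iota_isometric; have /andP[_ kC] := k_diag s.
  rewrite /feature_map isom; last exact: rkhs_kernel.
  rewrite /rkhs_norm rkhs_reproducing; last exact: rkhs_kernel.
  by rewrite -(ger0_norm (ltW C_gt0)) -sqrtr_sqr ler_wsqrtr.
have hstar : h (ystar x) = expectation_vec (pX x) (feature_map k iota).
  rewrite h_mean_embedding; apply/rowP => i; rewrite !mxE unlock.
  congr fine; apply: eq_measure_integral => A mA _; exact: ideal_translation.
rewrite opp_row_mx add_row_mx.
apply: (le_trans (norm2_row_mx_le _ _)); apply: lerD => //.
(* The sign flip puts [pX x] first, matching the order of arguments in [KL]. *)
rewrite -norm2N opprB hstar h_mean_embedding.
by apply: norm2_expectation_vecB_le => //; exact: ltW.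
Qed.
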